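(* Let $G$ be an abelian group (not necessarily torsionfree), let $R$ be a commutative Noetherian $G$-graded ring, and let $M$ be a finitely generated $G$-graded $R$-module. Then the following are equivalent. (1) Every graded-irreducible submodule of $M$ is irreducible. (2) For every graded submodule $N$ of $M$, $ir_M(N)=ir^g_M(N)$. (3) Every graded submodule $N$ of $M$ is a finite intersection of irreducible graded submodules of $M$. In particular, these equivalent conditions all hold if $G$ is a torsionfree abelian group.
   Context: A ring $R$ is $G$-graded if $R=\bigoplus_{g\in G}R_g$ with additive subgroups $R_g$ satisfying $R_gR_h\subset R_{g+h}$; an $R$-module $M$ is $G$-graded if $M=\bigoplus_{g\in G}M_g$ with additive subgroups $M_g$ satisfying $R_gM_h\subset M_{g+h}$. A graded submodule is a submodule generated by homogeneous elements. A submodule $N\subset M$ is irreducible if whenever $N_1,N_2$ are submodules of $M$ with $N_1\cap N_2=N$, then $N_1=N$ or $N_2=N$. A graded submodule $N$ of a graded module $M$ is graded-irreducible if whenever $N_1,N_2$ are $G$-graded submodules of $M$ with $N_1\cap N_2=N$, then $N_1=N$ or $N_2=N$. The index of reducibility of $N$ in $M$ is $ir_M(N)=\min\{r: N=\bigcap_{i=1}^r N_i,\ N_i \text{ irreducible } R\text{-submodules of } M\}$. When $M$ and $N$ are graded, the graded index of reducibility of $N$ in $M$ is $ir^g_M(N)=\min\{r: N=\bigcap_{i=1}^r N_i,\ N_i \text{ graded-irreducible } R\text{-submodules of } M\}$. *)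

(* Defs.v *)
From HB Require Import structures.
From mathcomp Require Import all_boot all_order all_algebra.
From mathcomp Require Import boolp classical_sets.

Set Implicit Arguments.
Unset Strict Implicit.
Unset Printing Implicit Defensive.

Import GRing.Theory.

Local Open Scope classical_set_scope.
Local Open Scope ring_scope.

Definition additive_subgroup (V : zmodType) (A : set V) : Prop :=
  zmod_closed (mem A).

(* V is the internal direct sum of the additive subgroups A g, for g in a
   possibly infinite index type G. *)
Definition direct_sum_decomposition (G V : zmodType) (A : G -> set V) : Prop :=
  [/\ forall g, additive_subgroup (A g),
      forall v : V, exists (s : seq G) (c : G -> V),
        (forall g, A g (c g)) /\ v = \sum_(g <- s) c g
    & forall (s : seq G) (c : G -> V), uniq s -> (forall g, A g (c g)) ->
        \sum_(g <- s) c g = 0 -> forall g, g \in s -> c g = 0].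

Definition ring_grading (G : zmodType) (R : comPzRingType) (Rg : G -> set R)
    : Prop :=
  direct_sum_decomposition Rg /\
  forall g h x y, Rg g x -> Rg h y -> Rg (g + h) (x * y).

Definition module_grading (G : zmodType) (R : comPzRingType) (M : lmodType R)
    (Rg : G -> set R) (Mg : G -> set M) : Prop :=
  direct_sum_decomposition Mg /\
  forall g h a x, Rg g a -> Mg h x -> Mg (g + h) (a *: x).

Definition submodule (R : comPzRingType) (M : lmodType R) (N : set M) : Prop :=
  submod_closed (mem N).

Definition generated_submodule (R : comPzRingType) (M : lmodType R)
    (S : set M) : set M :=
  smallest (@submodule R M) S.

Definition finitely_generated (R : comPzRingType) (M : lmodType R)
    (N : set M) : Prop :=
  exists s : seq M, N = generated_submodule [set` s].

(* The ideals of the commutative ring R are the submodules of R^o. *)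
Definition noetherian (R : comPzRingType) : Prop :=
  forall I : set R^o, submodule I -> finitely_generated I.

Definition homogeneous (G V : zmodType) (Vg : G -> set V) (x : V) : Prop :=
  exists g, Vg g x.

Definition graded_submodule (G : zmodType) (R : comPzRingType) (M : lmodType R)
    (Mg : G -> set M) (N : set M) : Prop :=
  exists2 S : set M, S `<=` homogeneous Mg & N = generated_submodule S.

(* Properness is not required: M itself counts as irreducible. *)
Definition irreducible_submodule (R : comPzRingType) (M : lmodType R)
    (N : set M) : Prop :=
  submodule N /\
  forall N1 N2 : set M, submodule N1 -> submodule N2 ->
    N1 `&` N2 = N -> N1 = N \/ N2 = N.

Definition graded_irreducible_submodule (G : zmodType) (R : comPzRingType)
    (M : lmodType R) (Mg : G -> set M) (N : set M) : Prop :=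
  graded_submodule Mg N /\
  forall N1 N2 : set M, graded_submodule Mg N1 -> graded_submodule Mg N2 ->
    N1 `&` N2 = N -> N1 = N \/ N2 = N.

(* The intersection of the empty family (r = 0) is the whole type T. *)
Definition intersection_of (T : Type) (P : set T -> Prop) (N : set T) (r : nat)
    : Prop :=
  exists2 F : 'I_r -> set T, forall i, P (F i)
    & N = \bigcap_(i in [set: 'I_r]) F i.

(* The least element of A; by convention 0 when A is empty. *)
Definition min_nat (A : set nat) : nat :=
  xget 0%N [set r | A r /\ forall k, A k -> (r <= k)%N].

Lemma min_natP (A : set nat) :
  A !=set0 -> A (min_nat A) /\ forall k, A k -> (min_nat A <= k)%N.
Proof.
move=> [n An]; rewrite /min_nat.
have exA : exists r, `[<A r>] by exists n; apply/asboolP.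
have [m /asboolP Am lem] := ex_minnP exA.
case: xgetP => [r _ //|/(_ m) []].
by split=> // k Ak; apply/lem/asboolP.
Qed.

Definition index_of_reducibility (R : comPzRingType) (M : lmodType R)
    (N : set M) : nat :=
  min_nat [set r | intersection_of (@irreducible_submodule R M) N r].

Definition graded_index_of_reducibility (G : zmodType) (R : comPzRingType)
    (M : lmodType R) (Mg : G -> set M) (N : set M) : nat :=
  min_nat [set r | intersection_of (graded_irreducible_submodule Mg) N r].

Definition torsionfree (G : zmodType) : Prop :=
  forall (g : G) (n : nat), (0 < n)%N -> g *+ n = 0 -> g = 0.

(* Main.v *)
Require Import Defs.
From HB Require Import structures.
From mathcomp Require Import all_boot all_order all_algebra.
From mathcomp Require Import boolp classical_sets.

(** Write C for the class of graded submodules. A finitely generated module M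
over a noetherian ring is noetherian, so every submodule in C is a finite
intersection of members of C that are irreducible within C: otherwise a maximal
counterexample would be a meet of two strictly larger members
([irreducible_in_decomposition]). The same holds for the class of all
submodules.

The three conditions are compared using only that C is stable under
intersections and contains M. If graded-irreducible submodules are irreducible,
a graded-irreducible decomposition is already one as in (3); conversely, a
graded-irreducible N that is a meet of irreducible graded submodules equals one
of them, or M. Graded-irreducible submodules are those of graded index at most
1, so equality of the two indices forces them to be irreducible. The remaining
implication is that a shortest irreducible decomposition can be turned into a
graded one that is no longer. This is Noether's exchange argument
([irreducible_exchange]): if N = K /\ L with L irreducible and N is also the
intersection of the A_j, then N is irreducible inside K, so N = K or
N = K /\ A_j for some j; the components are replaced one after the other.

Suppose now that G is torsionfree and N is graded-irreducible. Among the
homogeneous u outside N choose one with (N : u) maximal; this ideal is an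
associated prime of M / N. It is prime with respect to homogeneous scalars by
maximality, and then prime because nonempty finite subsets of G always have a
sum that is attained only once ([unique_sum], [maximal_colon_prime]).
Graded-irreducibility makes N + R v and N + R u meet outside N for every
homogeneous v outside N. Treating the components of an arbitrary x outside N
one at a time, some homogeneous scalar a moves x into N + R u while keeping it
outside N ([multiple_in_add_line]). So submodules N1 and N2 strictly
containing N contain elements c u and d u outside N, and then c d u is in
N1 /\ N2 and, by primality, outside N. *)

Set Implicit Arguments.
Unset Strict Implicit.
Unset Printing Implicit Defensive.

Import GRing.Theory.

Local Open Scope classical_set_scope.
Local Open Scope ring_scope.

(** * Submodules *)

Section Submodule.
Variables (R : comPzRingType) (M : lmodType R).
Implicit Types (N : set M) (S : set M).

Lemma submoduleP N :
  submodule N <-> N 0 /\ forall a x y, N x -> N y -> N (a *: x + y).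
Proof.
split=> [[N0 NL]|[N0 NL]]; split.
- by rewrite inE in N0.
- by move=> a x y Nx Ny; have := NL a x y; rewrite !inE; apply.
- by rewrite inE.
- by move=> a x y; rewrite !inE; apply: NL.
Qed.

Lemma submodule0 N : submodule N -> N 0.
Proof. by move=> /submoduleP[]. Qed.

Lemma submoduleD N x y : submodule N -> N x -> N y -> N (x + y).
Proof. by move=> /submoduleP[_ NL] Nx Ny; rewrite -[x]scale1r; apply: NL. Qed.

Lemma submoduleZ N a x : submodule N -> N x -> N (a *: x).
Proof. by move=> /submoduleP[N0 NL] Nx; rewrite -[_ *: _]addr0; apply: NL. Qed.

Lemma submoduleB N x y : submodule N -> N x -> N y -> N (x - y).
Proof.
move=> subN Nx Ny; rewrite -scaleN1r; apply: submoduleD => //.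
exact: submoduleZ.
Qed.

Lemma submoduleDl N x y : submodule N -> N x -> N (x + y) -> N y.
Proof.
by move=> subN Nx Nxy; rewrite -(addKr x y) addrC; apply: submoduleB.
Qed.

Lemma submodule_sum N (I : eqType) (s : seq I) (F : I -> M) :
  submodule N -> (forall i, i \in s -> N (F i)) -> N (\sum_(i <- s) F i).
Proof.
move=> subN NF; rewrite big_seq; elim/big_ind: _ => //.
  exact: submodule0.
by move=> x y; apply: submoduleD.
Qed.

Lemma submoduleT : submodule [set: M].
Proof. by apply/submoduleP. Qed.

Lemma submoduleI N N' : submodule N -> submodule N' -> submodule (N `&` N').
Proof.
move=> /submoduleP[N0 NL] /submoduleP[N'0 N'L]; apply/submoduleP.
by split=> // a x y [Nx N'x] [Ny N'y]; split; [apply: NL|apply: N'L].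
Qed.

Lemma generated_submodule_submodule S : submodule (generated_submodule S).
Proof.
apply/submoduleP; split=> [N [subN _]|a x y Sx Sy N [subN SN]].
  exact: submodule0.
by apply: submoduleD => //; [apply: submoduleZ => //; apply: Sx|apply: Sy].
Qed.

Definition add_line N (u : M) : set M :=
  [set x | exists2 n, N n & exists a : R, x = n + a *: u].

Lemma add_line_submodule N u : submodule N -> submodule (add_line N u).
Proof.
move=> subN; apply/submoduleP; split.
  by exists 0; [exact: submodule0|exists 0; rewrite scale0r addr0].
move=> a _ _ [m Nm [b ->]] [n Nn [c ->]].
exists (a *: m + n); first by apply: submoduleD => //; apply: submoduleZ.
exists (a * b + c).
by rewrite scalerDr scalerDl scalerA addrACA.
Qed.

Lemma sub_add_line N u : N `<=` add_line N u.
Proof. by move=> n Nn; exists n => //; exists 0; rewrite scale0r addr0. Qed.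

Lemma mem_add_line N u : submodule N -> add_line N u u.
Proof.
by move=> subN; exists 0; [exact: submodule0|exists 1; rewrite scale1r add0r].
Qed.

Lemma generated_submodule_cons x (s : seq M) v :
  generated_submodule [set` x :: s] v ->
  exists a : R, generated_submodule [set` s] (v - a *: x).
Proof.
have subs := generated_submodule_submodule [set` s].
move=> /(_ (add_line (generated_submodule [set` s]) x)) [].
  split; first exact: add_line_submodule.
  move=> y /=; rewrite inE => /predU1P[->|ys]; first exact: mem_add_line.
  by apply: sub_add_line; apply: sub_gen_smallest.
by move=> n sn [a ->]; exists a; rewrite addrK.
Qed.

End Submodule.

(** * Noetherian modules *)

Section Noetherian.
Variables (R : comPzRingType) (M : lmodType R).
Implicit Types (N : set M).

(** A submodule N of R x + K is controlled by its ideal of coefficients of x,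
which is finitely generated, and by its intersection with K, to which the
induction on the number of generators applies. *)
Lemma sub_span_finitely_generated (s : seq M) N : noetherian R ->
  submodule N -> N `<=` generated_submodule [set` s] -> finitely_generated N.
Proof.
move=> noethR; elim: s N => [|x s IH] N subN Ns.
  by exists [::]; apply/seteqP; split=> //; apply: smallest_sub.
set K := generated_submodule [set` s].
have subK : submodule K := generated_submodule_submodule _.
pose I : set R^o := [set a : R | exists2 m, K m & N (a *: x + m)].
have subI : submodule I.
  apply/submoduleP; split.
    exists 0; first exact: submodule0.
    by rewrite scale0r addr0; apply: submodule0.
  move=> c a b [m Km Nm] [n Kn Nn]; exists (c *: m + n).
    by apply: (submoduleD subK) => //; apply: (submoduleZ _ subK).
  rewrite scalerDl -scalerA addrACA -scalerDr.
  by apply: submoduleD => //; apply: submoduleZ.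
have [t It] := noethR I subI.
have /choice[f fP] (a : R) : exists m, I a -> K m /\ N (a *: x + m).
  by have [[m Km Nm]|NIa] := pselect (I a); [exists m|exists 0].
have [t' Nt'] : finitely_generated (N `&` K).
  by apply: IH; [apply: submoduleI|move=> v []].
pose T := [seq (a : R) *: x + f a | a <- t] ++ t'.
have subT := generated_submodule_submodule [set` T].
have TN : generated_submodule [set` T] `<=` N.
  apply: smallest_sub => // v /=; rewrite mem_cat => /orP[/mapP[a at_ ->]|vt'].
    by apply: (fP a _).2; rewrite It; apply: sub_gen_smallest.
  have : (N `&` K) v by rewrite Nt'; apply: sub_gen_smallest.
  by case.
exists T; apply/seteqP; split=> // v Nv.
have [a Kva] := generated_submodule_cons (Ns v Nv).
have : I a by exists (v - a *: x) => //; rewrite subrKC.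
(* It is enough that the coefficient a is attained, modulo K, by an element of
   the span of T; the coefficients with this property form an ideal that
   contains the generators t of I. *)
pose J : set R^o :=
  [set a : R | exists2 n, generated_submodule [set` T] n & K (n - a *: x)].
have subJ : submodule J.
  apply/submoduleP; split.
    by exists 0; rewrite ?scale0r ?subr0; apply: submodule0.
  move=> c b b' [m Tm Km] [n Tn Kn]; exists (c *: m + n).
    by apply: (submoduleD subT) => //; apply: (submoduleZ _ subT).
  rewrite scalerDl -scalerA opprD addrACA -scalerBr.
  by apply: (submoduleD subK) => //; apply: (submoduleZ _ subK).
rewrite It => /(smallest_sub subJ)[b bt|n Tn Kn].
  have Ib : I b by rewrite It; apply: sub_gen_smallest.
  exists (b *: x + f b); last by rewrite addrC addKr; case: (fP b Ib).
  apply: sub_gen_smallest; rewrite /= mem_cat; apply/orP; left.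
  by apply/mapP; exists b.
rewrite -(subrKC n v); apply: (submoduleD subT) => //.
have : (N `&` K) (v - n).
  split; first by apply: submoduleB => //; apply: TN.
  have -> : v - n = (v - a *: x) - (n - a *: x) by rewrite opprB addrA subrK.
  exact: (submoduleB subK).
rewrite Nt'; apply: smallest_sub => // w wt'; apply: sub_gen_smallest.
by rewrite /= mem_cat; apply/orP; right.
Qed.

Lemma submodule_finitely_generated N : noetherian R ->
  finitely_generated [set: M] -> submodule N -> finitely_generated N.
Proof.
move=> noethR [s Ms] subN.
by apply: (@sub_span_finitely_generated s) => //; rewrite -Ms.
Qed.

(** A counterexample could be enlarged forever; the union of the resulting chain
is finitely generated, hence equal to one of its members. *)
Lemma noetherian_ind (P : set M -> Prop) :
  (forall N, submodule N -> finitely_generated N) ->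
  (forall N, submodule N ->
     (forall N', submodule N' -> N `<=` N' -> N' <> N -> P N') -> P N) ->
  forall N, submodule N -> P N.
Proof.
move=> fgM step N subN; apply: contrapT => NPN.
pose bad N := submodule N /\ ~ P N.
have /choice[f fP] N1 : exists N', bad N1 -> [/\ bad N', N1 `<=` N' & N' <> N1].
  have [[subN1 NPN1]|?] := pselect (bad N1); last by exists N1.
  apply: contrapT => noN'; apply/NPN1/step => // N' subN' NN' neq.
  by apply: contrapT => NPN'; apply: noN'; exists N'.
pose u i := iter i f N.
have bad_u i : bad (u i) by elim: i => // i /fP[].
have u_mono i j : (i <= j)%N -> u i `<=` u j.
  move=> /subnK <-; elim: (j - i)%N => // k IH.
  by apply: subset_trans IH _; case: (fP (u (k + i)%N)).
have subU : submodule (\bigcup_i u i).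
  apply/submoduleP; split; first by exists 0%N => //; apply: submodule0.
  move=> a x y [i _ ux] [j _ uy]; exists (maxn i j) => //.
  apply: submoduleD; first by case: (bad_u (maxn i j)).
    apply: submoduleZ; first by case: (bad_u (maxn i j)).
    by apply: u_mono ux; apply: leq_maxl.
  by apply: u_mono uy; apply: leq_maxr.
have [s Us] := fgM _ subU.
have [k sk] : exists k, [set` s] `<=` u k.
  have : [set` s] `<=` \bigcup_i u i by rewrite Us; apply: sub_gen_smallest.
  elim: s {Us} => [|x s IH] sU; first by exists 0%N => x; rewrite /= in_nil.
  have [i _ ux] : (\bigcup_i u i) x by apply: sU; rewrite /= mem_head.
  have [|j sj] := IH; first by move=> y ys; apply: sU; rewrite /= in_cons ys orbT.
  exists (maxn i j) => y /=; rewrite in_cons => /predU1P[->|/sj].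
    by apply: u_mono ux; apply: leq_maxl.
  by apply: u_mono; apply: leq_maxr.
have [_ uk] := fP _ (bad_u k); apply; apply/seteqP; split=> // x ux.
have : (\bigcup_i u i) x by exists k.+1.
by rewrite Us; apply: smallest_sub => //; case: (bad_u k).
Qed.

End Noetherian.
(** * Finite intersections *)

Section FiniteIntersection.
Variables (T : Type) (P : set T -> Prop).

Lemma intersection_of0 N : intersection_of P N 0 <-> N = setT.
Proof.
split=> [[F _ ->]|->].
  by apply/seteqP; split=> // x _ [].
by exists (fun=> setT) => [[]|] //; apply/seteqP; split=> // x _ [].
Qed.

Lemma intersection_ofS N r : intersection_of P N r.+1 <->
  exists A B, [/\ P A, intersection_of P B r & N = A `&` B].
Proof.
split=> [[F PF ->]|[A [B [PA [F PF ->] ->]]]].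
  exists (F ord0), (\bigcap_(i in [set: 'I_r]) F (lift ord0 i)); split=> //.
    by exists (fun i => F (lift ord0 i)).
  apply/seteqP; split=> [x Fx|x [F0x Fx] i _].
    by split=> [|i _]; apply: Fx.
  by case: (unliftP ord0 i) => [j|] -> //; apply: Fx.
exists (fun i => if unlift ord0 i is Some j then F j else A).
  by move=> i; case: (unlift ord0 i).
apply/seteqP; split=> [x [Ax Fx] i _|x FAx].
  by case: (unlift ord0 i) => // j; apply: Fx.
split; first by have := FAx ord0 I; rewrite unlift_none.
by move=> j _; have := FAx (lift ord0 j) I; rewrite liftK.
Qed.

Lemma intersection_of1 N : intersection_of P N 1 <-> P N.
Proof.
split=> [/intersection_ofS[A [B [PA /intersection_of0-> ->]]]|PN].
  by rewrite setIT.
by apply/intersection_ofS; exists N, setT; split;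
  rewrite ?setIT //; apply/intersection_of0.
Qed.

Lemma intersection_ofI A B r s :
  intersection_of P A r -> intersection_of P B s ->
  intersection_of P (A `&` B) (r + s).
Proof.
elim: r A => [|r IH] A; first by move=> /intersection_of0->; rewrite setTI.
move=> /intersection_ofS[A1 [A2 [PA1 IA2 ->]]] IB; rewrite addSn -setIA.
by apply/intersection_ofS; exists A1, (A2 `&` B); split=> //; apply: IH.
Qed.

Lemma intersection_of_stable (C : set T -> Prop) N r :
  C setT -> (forall A B, C A -> C B -> C (A `&` B)) ->
  (forall A, P A -> C A) -> intersection_of P N r -> C N.
Proof.
move=> CT CI PC; elim: r N => [N /intersection_of0-> //|r IH N].
by move=> /intersection_ofS[A [B [PA IB ->]]]; apply: CI; [apply: PC|apply: IH].
Qed.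

End FiniteIntersection.

Lemma intersection_of_sub (T : Type) (P Q : set T -> Prop) N r :
  (forall A, P A -> Q A) -> intersection_of P N r -> intersection_of Q N r.
Proof. by move=> PQ [F PF ->]; exists F => // i; apply: PQ. Qed.

(** * Irreducible decompositions *)

(** Irreducible submodules and graded-irreducible submodules are both of the
form [irreducible_in C], for C the class of all submodules and the class of
graded submodules. *)
Definition irreducible_in (T : Type) (C : set T -> Prop) (N : set T) : Prop :=
  C N /\ forall N1 N2, C N1 -> C N2 -> N1 `&` N2 = N -> N1 = N \/ N2 = N.

Section Decomposition.
Variables (R : comPzRingType) (M : lmodType R) (C : set M -> Prop).
Hypothesis fgM : forall N : set M, submodule N -> finitely_generated N.
Hypothesis submoduleC : forall N, C N -> submodule N.

Lemma irreducible_in_decomposition N :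
  C N -> exists r, intersection_of (irreducible_in C) N r.
Proof.
move=> CN; have subN := submoduleC CN; move: N subN CN.
apply: (noetherian_ind fgM) => N subN IH CN.
have [irrN|] := pselect (irreducible_in C N).
  by exists 1%N; apply/intersection_of1.
move=> /not_andP[//|/existsNP[A /existsNP[B]]].
move=> /not_implyP[CA /not_implyP[CB /not_implyP[AB /not_orP[AN BN]]]].
have [r Ar] : exists r, intersection_of (irreducible_in C) A r.
  by apply: IH => //; [exact: submoduleC|rewrite -AB => x []].
have [s Bs] : exists r, intersection_of (irreducible_in C) B r.
  by apply: IH => //; [exact: submoduleC|rewrite -AB => x []].
by exists (r + s)%N; rewrite -AB; apply: intersection_ofI.
Qed.

(** Peel off one member of the intersection at a time: either it is N, or N is
the intersection of the others. The empty intersection leaves M. *)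
Lemma irreducible_in_intersection N (Q : set M -> Prop) r :
  C setT -> (forall A B, C A -> C B -> C (A `&` B)) ->
  irreducible_in C N -> (forall A, Q A -> C A) -> intersection_of Q N r ->
  N = setT \/ Q N.
Proof.
move=> CT CI irrN QC; elim: r N irrN => [|r IH] N irrN.
  by move=> /intersection_of0->; left.
move=> /intersection_ofS[A [B [QA IB NAB]]].
have CB : C B := intersection_of_stable CT CI QC IB.
case: (irrN.2 A B (QC _ QA) CB) => // [<-|BN]; first by right.
by apply: IH => //; rewrite -BN.
Qed.

End Decomposition.

(** * Noether's exchange argument *)

Section Exchange.
Variables (R : comPzRingType) (M : lmodType R).
Implicit Types K L N : set M.

(** Modulo [N = K `&` L] the module K embeds into M / L, where 0 is
irreducible; hence N is irreducible inside K. *)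
Lemma irreducible_submodule_cap K L A B : irreducible_submodule L ->
  submodule K -> submodule A -> submodule B -> A `<=` K -> B `<=` K ->
  A `&` B = K `&` L -> A = K `&` L \/ B = K `&` L.
Proof.
move=> [subL irrL] subK subA subB AK BK AB.
(* sum X is X + L: if A and B meet in K /\ L, then A + L and B + L meet in L. *)
pose sum X := [set x | exists2 a, X a & L (x - a)] : set M.
have sub_sum X : submodule X -> submodule (sum X).
  move=> subX; apply/submoduleP; split.
    by exists 0; rewrite ?subr0; apply: submodule0.
  move=> c x y [a Xa Lxa] [b Xb Lyb]; exists (c *: a + b).
    by apply: submoduleD => //; apply: submoduleZ.
  rewrite opprD addrACA -scalerBr.
  by apply: submoduleD => //; apply: submoduleZ.
have sumL X : X `<=` K -> K `&` L `<=` X -> sum X = L -> X = K `&` L.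
  move=> XK KLX XL; apply/seteqP; split=> // x Xx; split; first exact: XK.
  by rewrite -XL; exists x => //; rewrite subrr; apply: submodule0.
have KLA : K `&` L `<=` A by rewrite -AB => x [].
have KLB : K `&` L `<=` B by rewrite -AB => x [].
case: (irrL (sum A) (sum B)); [exact: sub_sum|exact: sub_sum|
  |by left; apply: sumL|by right; apply: sumL].
apply/seteqP; split=> [x [[a Aa La] [b Bb Lb]]|x Lx]; last first.
  by split; exists 0; rewrite ?subr0 //; apply: submodule0.
have Lab : L (a - b).
  have -> : a - b = (x - b) - (x - a) by rewrite opprB [RHS]addrC addrA subrK.
  exact: submoduleB.
have Bab : B (a - b).
  by apply: KLB; split=> //; apply: submoduleB => //; [apply: AK|apply: BK].
have : (A `&` B) a.
  by split=> //; rewrite -(subrK b a); apply: submoduleD.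
rewrite AB => -[_ Laa]; rewrite -(subrK a x); exact: submoduleD.
Qed.

(** Intersecting a decomposition of N with K presents N as a meet of submodules
of K, in which N is irreducible. *)
Lemma irreducible_in_cap_decomposition (P : set M -> Prop) K N L s :
  (forall A, P A -> submodule A) -> submodule K -> irreducible_submodule L ->
  N = K `&` L -> intersection_of P N s ->
  K = N \/ exists2 A, P A & N = K `&` A.
Proof.
move=> subP subK irrL NKL NPs.
(* Only N = K /\ B survives when members of P are peeled off B. *)
have : exists2 B, submodule B & intersection_of P B s /\ N = K `&` B.
  exists N; last by split=> //; rewrite NKL setIA setIid.
  by rewrite NKL; case: irrL => subL _; apply: submoduleI.
elim: s {NPs} => [|s IH] [B subB [BPs NKB]].
  by left; rewrite NKB; move/intersection_of0: BPs => ->; rewrite setIT.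
have [A [B' [PA B'Ps BAB']]] := (intersection_ofS P B s).1 BPs.
have subB' : submodule B' :=
  intersection_of_stable (submoduleT M) (@submoduleI _ M) subP B'Ps.
have subKA : submodule (K `&` A) by apply: submoduleI => //; apply: subP.
have subKB' : submodule (K `&` B') by apply: submoduleI.
have NAB' : (K `&` A) `&` (K `&` B') = K `&` L.
  by rewrite setIACA setIid -BAB' -NKB.
have [||KAN|KBN] := irreducible_submodule_cap irrL subK subKA subKB' _ _ NAB'.
- exact: subIsetl.
- exact: subIsetl.
- by right; exists A; rewrite // KAN.
- by apply: IH; exists B'; rewrite // KBN.
Qed.

(** K collects the members of P that have replaced components so far; r' may be
smaller than r because a component that K makes redundant is dropped. *)
Lemma irreducible_exchange (P : set M -> Prop) K N B r s :
  (forall A, P A -> submodule A) -> submodule K ->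
  intersection_of (@irreducible_submodule R M) B r ->
  N = K `&` B -> intersection_of P N s ->
  exists2 r', (r' <= r)%N &
    exists2 A, intersection_of P A r' & N = K `&` A.
Proof.
move=> subP + + + NPs; elim: r K B => [|r IH] K B subK.
  move=> /intersection_of0-> ->; exists 0%N => //.
  by exists setT => //; apply/intersection_of0.
move=> /intersection_ofS[L [B' [irrL IB' ->]]] NKLB'.
have subB' : submodule B'.
  apply: intersection_of_stable IB' => //; [exact: submoduleT| |by move=> A []].
  exact: submoduleI.
have subKB' : submodule (K `&` B') by apply: submoduleI.
have NKB'L : N = K `&` B' `&` L by rewrite NKLB' (setIC L) setIA.
have [KN|[A PA NA]] :=
    irreducible_in_cap_decomposition subP subKB' irrL NKB'L NPs.
  have [r' r'r [A IA NA]] := IH K B' subK IB' (esym KN).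
  by exists r'; [apply: leqW|exists A].
have subKA : submodule (K `&` A) by apply: submoduleI => //; apply: subP.
have [|r' r'r [A' IA' NA']] := IH (K `&` A) B' subKA IB'.
  by rewrite NA setIAC.
exists r'.+1 => //; exists (A `&` A'); last by rewrite setIA.
by apply/intersection_ofS; exists A, A'.
Qed.

End Exchange.

(** * Comparison of the two indices of reducibility *)

Section Equivalence.
Variables (R : comPzRingType) (M : lmodType R) (C : set M -> Prop).
Hypothesis fgM : forall N : set M, submodule N -> finitely_generated N.
Hypothesis submoduleC : forall N, C N -> submodule N.
Hypothesis CT : C setT.
Hypothesis CI : forall A B, C A -> C B -> C (A `&` B).

Let irr := @irreducible_submodule R M.
Let index P (N : set M) := min_nat [set r | intersection_of P N r].

Lemma irreducible_setT : irr setT.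
Proof.
split; first exact: submoduleT.
by move=> A B _ _ AB; left; apply/seteqP; split=> // x; rewrite -AB => -[].
Qed.

Lemma irreducible_in_index :
  (forall N, irreducible_in C N -> irr N) ->
  forall N, C N -> index irr N = index (irreducible_in C) N.
Proof.
move=> Cirr N CN.
have ex := irreducible_in_decomposition fgM submoduleC CN.
have [I1 min1] := min_natP ex.
have [I2 min2] : _ /\ _ := @min_natP [set r | intersection_of irr N r]
  (let: ex_intro r Ir := ex in ex_intro _ r (intersection_of_sub Cirr Ir)).
apply/eqP; rewrite eqn_leq; apply/andP; split.
  by apply: min2; apply: intersection_of_sub I1.
have sub_irrC A : irreducible_in C A -> submodule A by case=> /submoduleC.
have [|r' r'r [A IA NA]] :=
    irreducible_exchange sub_irrC (submoduleT M) I2 _ I1.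
  by rewrite setTI.
apply: leq_trans r'r; apply: min1.
by rewrite /= NA setTI.
Qed.

Lemma index_irreducible_in :
  (forall N, C N -> index irr N = index (irreducible_in C) N) ->
  forall N, irreducible_in C N -> irr N.
Proof.
move=> eq_index N irrN.
have [Iirr _] := min_natP
  (irreducible_in_decomposition fgM (fun _ => id) (submoduleC irrN.1)).
have IN : intersection_of (irreducible_in C) N 1 by apply/intersection_of1.
have [_ /(_ _ IN)] := @min_natP [set r | _] (ex_intro _ 1%N IN).
rewrite -/(index _ N) -eq_index; last exact: irrN.1.
move: Iirr; rewrite -/(index irr N) /=.
case: (index irr N) => [/intersection_of0-> _|[|//] /intersection_of1//].
exact: irreducible_setT.
Qed.

Lemma irreducible_in_meet :
  (forall N, irreducible_in C N -> irr N) <->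
  forall N, C N -> exists r, intersection_of (fun L => irr L /\ C L) N r.
Proof.
split=> [Cirr N CN|ICirr N irrN].
  have [r Ir] := irreducible_in_decomposition fgM submoduleC CN.
  by exists r; apply: intersection_of_sub Ir => L irrL; split;
    [exact: Cirr|exact: irrL.1].
have [r Ir] := ICirr N irrN.1.
by case: (irreducible_in_intersection CT CI irrN _ Ir) => [L []//|->|[]//];
  exact: irreducible_setT.
Qed.

End Equivalence.
(** * Homogeneous components *)

Section Component.
Variables (G V : zmodType) (A : G -> set V).

(** The family c is finitely supported with sum v. Quantifying over all lists
that extend a fixed one encodes this without carrying the support around, and
makes sums of such families immediate. *)
Definition component_family (v : V) (c : G -> V) : Prop :=
  (forall g, A g (c g)) /\
  exists s : seq G, forall t, uniq t -> {subset s <= t} ->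
    v = \sum_(g <- t) c g.

(** By uniqueness of decompositions the choice is immaterial; making it in V
gives a total function that does not depend on the proof of the grading. *)
Definition component (g : G) (v : V) : V :=
  xget 0 [set x | exists2 c, component_family v c & x = c g].

Hypothesis decA : direct_sum_decomposition A.

Lemma piece0 g : A g 0.
Proof. by have [/(_ g)[+ _] _ _] := decA; rewrite inE. Qed.

Lemma pieceB g x y : A g x -> A g y -> A g (x - y).
Proof.
by move=> Ax Ay; have [/(_ g)[_ /(_ x y)] + _ _] := decA; rewrite !inE; apply.
Qed.

Lemma pieceD g x y : A g x -> A g y -> A g (x + y).
Proof.
move=> Ax Ay; rewrite -[y]opprK; apply: pieceB => //.
by rewrite -sub0r; apply: pieceB => //; apply: piece0.
Qed.

Lemma component_familyD v w c d : component_family v c ->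
  component_family w d -> component_family (v + w) (fun g => c g + d g).
Proof.
move=> [Ac [s vs]] [Ad [t wt]]; split; first by move=> g; apply: pieceD.
exists (s ++ t) => r ur str; rewrite big_split -vs // -?wt //.
  by move=> g gt; apply: str; rewrite mem_cat gt orbT.
by move=> g gs; apply: str; rewrite mem_cat gs.
Qed.

Lemma component_familyN v c : component_family v c ->
  component_family (- v) (fun g => - c g).
Proof.
move=> [Ac [s vs]]; split.
  by move=> g; rewrite -sub0r; apply: pieceB => //; apply: piece0.
by exists s => t ut st; rewrite sumrN -vs.
Qed.

Lemma component_family_homogeneous g v : A g v ->
  component_family v (fun h => if h == g then v else 0).
Proof.
move=> Av; split=> [h|]; first by case: eqP => [->//|_]; apply: piece0.
exists [:: g] => t ut gt; rewrite (bigD1_seq g) ?gt ?mem_head //= eqxx big1 ?addr0//.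
by move=> h /negPf->.
Qed.

Lemma component_family_ex v : exists c, component_family v c.
Proof.
have [_ /(_ v)[s [c [Ac ->]]] _] := decA.
elim: s => [|g s [d famd]].
  exists (fun=> 0); split=> [g|]; first exact: piece0.
  by exists [::] => t _ _; rewrite big_nil big1.
rewrite big_cons; have famc := component_family_homogeneous (Ac g).
by exists (fun h => (if h == g then c g else 0) + d h); apply: component_familyD.
Qed.

Lemma component_family_uniq v c d : component_family v c ->
  component_family v d -> c = d.
Proof.
move=> famc famd; apply/funext => g; apply/eqP; rewrite -subr_eq0; apply/eqP.
have [AB [s s0]] := component_familyD famc (component_familyN famd).
have [_ _ /(_ (undup (g :: s)) _ (undup_uniq _) AB)] := decA; apply.
  by rewrite -s0 ?subrr ?undup_uniq // => h hs; rewrite mem_undup in_cons hs orbT.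
by rewrite mem_undup mem_head.
Qed.

Lemma component_familyE v c : component_family v c -> component^~ v = c.
Proof.
move=> famc; apply/funext => g; rewrite /component.
case: xgetP => [_ _ [d famd ->]|/(_ (c g))[]].
  by rewrite (component_family_uniq famc famd).
by exists c.
Qed.

Lemma component_familyP v : component_family v (component^~ v).
Proof.
by have [c famc] := component_family_ex v; rewrite (component_familyE famc).
Qed.

Lemma component_in g v : A g (component g v).
Proof. by case: (component_familyP v). Qed.

Lemma componentD g v w : component g (v + w) = component g v + component g w.
Proof.
have fam := component_familyD (component_familyP v) (component_familyP w).
exact: (congr1 (@^~ g) (component_familyE fam)).
Qed.

Lemma component_homogeneous g h v :
  A g v -> component h v = if h == g then v else 0.
Proof.
move=> Av; have fam := component_family_homogeneous Av.
exact: (congr1 (@^~ h) (component_familyE fam)).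
Qed.

Lemma component_id g v : A g v -> component g v = v.
Proof. by move=> Av; rewrite (component_homogeneous g Av) eqxx. Qed.

Lemma component0 g : component g 0 = 0.
Proof. exact/component_id/piece0. Qed.

Lemma component_sum g (I : Type) (s : seq I) (F : I -> V) :
  component g (\sum_(i <- s) F i) = \sum_(i <- s) component g (F i).
Proof. exact: (big_morph _ (componentD g) (component0 g)). Qed.

Lemma sum_component v : exists s : seq G,
  [/\ uniq s, v = \sum_(g <- s) component g v
    & forall g, g \notin s -> component g v = 0].
Proof.
have [_ [s vs]] := component_familyP v.
have uv := vs _ (undup_uniq s); exists (undup s).
have {}uv : v = \sum_(g <- undup s) component g v.
  by apply: uv => g; rewrite mem_undup.
split=> // [|g gs]; first exact: undup_uniq.
have : v = \sum_(h <- g :: undup s) component h v.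
  apply: vs => [|h hs]; first by rewrite /= gs undup_uniq.
  by rewrite in_cons mem_undup hs orbT.
by rewrite big_cons -uv -{1}(add0r v) => /addIr.
Qed.

End Component.

(** * Graded submodules *)

Section GradedModule.
Variables (G : zmodType) (R : comPzRingType) (Rg : G -> set R).
Variables (M : lmodType R) (Mg : G -> set M).
Hypotheses (gradR : ring_grading Rg) (gradM : module_grading Rg Mg).

Let decR : direct_sum_decomposition Rg := gradR.1.
Let decM : direct_sum_decomposition Mg := gradM.1.

Lemma piece_scale g h a x : Rg g a -> Mg h x -> Mg (g + h) (a *: x).
Proof. by have [_] := gradM; apply. Qed.

Lemma homogeneousM a b :
  homogeneous Rg a -> homogeneous Rg b -> homogeneous Rg (a * b).
Proof.
have [_ mulR] := gradR.
by move=> [g Ra] [h Rb]; exists (g + h); apply: mulR.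
Qed.

Lemma homogeneousZ a x :
  homogeneous Rg a -> homogeneous Mg x -> homogeneous Mg (a *: x).
Proof. by move=> [g Ra] [h Mx]; exists (g + h); apply: piece_scale. Qed.

Lemma component_scale_homogeneous g k a x :
  Rg g a -> component Mg k (a *: x) = a *: component Mg (k - g) x.
Proof.
move=> Ra; have [s [us xs s0]] := sum_component decM x.
rewrite {1}xs scaler_sumr (component_sum decM).
have term h : component Mg k (a *: component Mg h x) =
    if h == k - g then a *: component Mg h x else 0.
  rewrite (@component_homogeneous _ _ _ decM (g + h)).
    by rewrite [h == _]eq_sym subr_eq addrC.
  by apply: piece_scale => //; apply: component_in.
rewrite (eq_bigr _ (fun h _ => term h)) -big_mkcond /=.
have [ks|ks] := boolP (k - g \in s).
  by rewrite -big_filter filter_pred1_uniq // big_seq1.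
by rewrite s0 // scaler0 big_seq_cond big_pred0 // => h;
  apply/andP => -[hs /eqP hE]; rewrite -hE hs in ks.
Qed.

Lemma component_scale_of_homogeneous h k a x :
  Mg h x -> component Mg k (a *: x) = component Rg (k - h) a *: x.
Proof.
move=> Mx; have [s [us as_ s0]] := sum_component decR a.
rewrite {1}as_ scaler_suml (component_sum decM).
have term g : component Mg k (component Rg g a *: x) =
    if g == k - h then component Rg g a *: x else 0.
  rewrite (@component_homogeneous _ _ _ decM (g + h)).
    by rewrite [g == _]eq_sym subr_eq.
  by apply: piece_scale => //; apply: component_in.
rewrite (eq_bigr _ (fun h _ => term h)) -big_mkcond /=.
have [ks|ks] := boolP (k - h \in s).
  by rewrite -big_filter filter_pred1_uniq // big_seq1.
by rewrite s0 // scale0r big_seq_cond big_pred0 // => g;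
  apply/andP => -[gs /eqP gE]; rewrite -gE gs in ks.
Qed.

(** The elements whose components all lie in N form a submodule: scaling by a
homogeneous element only shifts components. *)
Lemma graded_submoduleP N : graded_submodule Mg N <->
  submodule N /\ forall g x, N x -> N (component Mg g x).
Proof.
split=> [[S Shom NE]|[subN compN]]; last first.
  exists (N `&` homogeneous Mg); first exact: subIsetr.
  apply/seteqP; split; last by apply: smallest_sub => // x [].
  move=> x Nx; have [s [_ -> _]] := sum_component decM x.
  apply: submodule_sum; first exact: generated_submodule_submodule.
  move=> g _; apply: sub_gen_smallest; split; first exact: compN.
  by exists g; apply: component_in.
have subN : submodule N by rewrite NE; apply: generated_submodule_submodule.
split=> // g x.
pose T := [set x | forall g, N (component Mg g x)].
suff subT : submodule T.
  suff NT : N `<=` T by move/NT.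
  rewrite {1}NE; apply: smallest_sub => // {g}x Sx g; have [h Mx] := Shom x Sx.
  rewrite (component_homogeneous decM _ Mx); case: eqP => _; last exact: submodule0.
  by rewrite NE; apply: sub_gen_smallest.
apply/submoduleP; split=> [h|a {g}x y Tx Ty g].
  by rewrite component0 //; exact: submodule0.
rewrite (componentD decM); apply: (submoduleD subN); last exact: Ty.
have [s [_ -> _]] := sum_component decR a.
rewrite scaler_suml (component_sum decM); apply: (submodule_sum subN) => h _.
rewrite (component_scale_homogeneous _ _ (component_in decR h a)).
by apply: submoduleZ.
Qed.

Lemma graded_submodule_submodule N : graded_submodule Mg N -> submodule N.
Proof. by case/graded_submoduleP. Qed.

Lemma graded_submoduleT : graded_submodule Mg setT.
Proof. by apply/graded_submoduleP; split=> //; apply: submoduleT. Qed.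

Lemma graded_submoduleI A B : graded_submodule Mg A ->
  graded_submodule Mg B -> graded_submodule Mg (A `&` B).
Proof.
move=> /graded_submoduleP[subA cA] /graded_submoduleP[subB cB].
apply/graded_submoduleP; split; first exact: submoduleI.
by move=> g x [Ax Bx]; split; [apply: cA|apply: cB].
Qed.

Lemma graded_submodule_add_line N h u : graded_submodule Mg N -> Mg h u ->
  graded_submodule Mg (add_line N u).
Proof.
move=> /graded_submoduleP[subN cN] Mu; apply/graded_submoduleP.
split=> [|g _ [n Nn [a ->]]]; first exact: add_line_submodule.
exists (component Mg g n); first exact: cN.
exists (component Rg (g - h) a).
by rewrite (componentD decM) (component_scale_of_homogeneous _ _ Mu).
Qed.

Lemma component_notin N x : submodule N -> ~ N x ->
  exists g, ~ N (component Mg g x).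
Proof.
move=> subN NNx; apply: contrapT => /forallNP Nc; apply: NNx.
have [s [_ -> _]] := sum_component decM x.
by apply: submodule_sum => // g _; apply: contrapT (Nc g).
Qed.

End GradedModule.

(** * Unique sums in torsionfree abelian groups *)

Section UniqueSum.
Variable G : zmodType.

(** P is the nonnegative cone of a translation-invariant partial order. *)
Definition pointed_cone (P : set G) : Prop :=
  [/\ P 0, forall x y, P x -> P y -> P (x + y)
    & forall x, P x -> P (- x) -> x = 0].

Definition extend_cone (P : set G) (e : G) : set G :=
  [set x | exists p n, P p /\ x = p + e *+ n].

(** If x and -x are p + m e and q + n e, then adding them gives
-(m + n) e = p + q, which is in P. *)
Lemma extend_cone_pointed P e : pointed_cone P ->
  pointed_cone (extend_cone P e) \/ exists2 k, (0 < k)%N & P (- (e *+ k)).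
Proof.
move=> [P0 PD PN]; have [?|noK] := pselect (exists2 k, (0 < k)%N & P (- (e *+ k))).
  by right.
left; split.
- by exists 0, 0%N; rewrite addr0.
- move=> _ _ [p [m [Pp ->]]] [q [n [Pq ->]]]; exists (p + q), (m + n)%N.
  by split; [apply: PD|rewrite mulrnDr addrACA].
move=> _ [p [m [Pp ->]]] [q [n [Pq qE]]].
have pqE : - (e *+ (m + n)) = p + q.
  apply/eqP; rewrite eq_sym -subr_eq0 opprK mulrnDr addrACA -qE.
  by rewrite subrr.
have [mn0|mn_gt0] := posnP (m + n); last first.
  by case: noK; exists (m + n)%N => //; rewrite pqE; apply: PD.
move: mn0 pqE => /eqP; rewrite addn_eq0 => /andP[/eqP-> /eqP->].
rewrite mulr0n oppr0 addr0 => /esym/eqP; rewrite addrC addr_eq0 => /eqP pq.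
by apply: PN => //; rewrite -pq.
Qed.

Lemma coneM P x n : pointed_cone P -> P x -> P (x *+ n).
Proof.
by move=> [P0 PD _] Px; elim: n => // n IH; rewrite mulrS; apply: PD.
Qed.

(** Adjoining d or -d to P keeps it pointed: if both fail, then P contains
negative multiples of d and of -d, hence x and -x for a nonzero multiple x of
d. *)
Lemma cone_deciding (D : seq G) : torsionfree G ->
  exists2 P, pointed_cone P & forall d, d \in D -> P d \/ P (- d).
Proof.
move=> tf; elim: D => [|d D [P coneP decP]].
  exists [set 0] => //; split=> // x y -> ->; exact: addr0.
have [Pd|NPd] := pselect (P d \/ P (- d)).
  by exists P => // e; rewrite in_cons => /predU1P[->//|/decP].
have ext e : pointed_cone (extend_cone P e) -> e = d \/ e = - d ->
    exists2 P, pointed_cone P & forall x, x \in d :: D -> P x \/ P (- x).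
  move=> coneQ eE; exists (extend_cone P e) => // x; have [P0 _ _] := coneP.
  have Pe : extend_cone P e e by exists 0, 1%N; rewrite add0r.
  rewrite in_cons => /predU1P[->|/decP].
    by case: eE Pe => ->; [left|right].
  have PQ y : P y -> extend_cone P e y by exists y, 0%N; rewrite addr0.
  by case=> /PQ; [left|right].
have [/ext|[k k0 Pk]] := extend_cone_pointed d coneP; first by apply; left.
have [/ext|[l l0 Pl]] := extend_cone_pointed (- d) coneP; first by apply; right.
have d0 : d = 0.
  apply: (tf _ (k * l)%N); first by rewrite muln_gt0 k0.
  have [_ _ PN] := coneP; apply: PN.
    by rewrite mulnC mulrnA -[d]opprK mulNrn; apply: coneM.
  by rewrite mulrnA -mulNrn; apply: coneM.
by case: NPd; left; rewrite d0; case: coneP.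
Qed.

Lemma cone_max P (S : seq G) : pointed_cone P -> S != [::] ->
  (forall g h, g \in S -> h \in S -> P (g - h) \/ P (- (g - h))) ->
  exists2 m, m \in S & forall g, g \in S -> P (m - g).
Proof.
move=> [P0 PD _]; elim: S => // x [|y S] IH _ decS.
  by exists x; rewrite ?mem_head // => g; rewrite inE => /eqP->; rewrite subrr.
have [//|g h gS hS|m mS mP] := IH.
  by apply: decS; rewrite in_cons ?gS ?hS orbT.
have mS' : m \in [:: x, y & S] by rewrite in_cons mS orbT.
have [Pxm|] := decS x m (mem_head _ _) mS'.
  exists x; first exact: mem_head.
  move=> g; rewrite in_cons => /predU1P[->|/mP Pmg]; first by rewrite subrr.
  by rewrite -(subrK m x) -addrA; apply: PD.
rewrite opprB => Pmx; exists m => //.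
by move=> g; rewrite in_cons => /predU1P[->|/mP].
Qed.

(** Order the finitely many elements involved by a cone that decides their
differences; the sum of the two maxima is attained only once. *)
Lemma unique_sum (S T : seq G) : torsionfree G -> S != [::] -> T != [::] ->
  exists g h, [/\ g \in S, h \in T & forall g' h',
    g' \in S -> h' \in T -> g' + h' = g + h -> g' = g].
Proof.
move=> tf S0 T0.
pose D := [seq x - y | x <- S, y <- S] ++ [seq x - y | x <- T, y <- T].
have [P coneP decP] := cone_deciding D tf.
have [|g gS gP] := cone_max coneP S0.
  move=> x y xS yS; apply: decP; rewrite mem_cat; apply/orP; left.
  exact: allpairs_f.
have [|h hT hP] := cone_max coneP T0.
  move=> x y xS yS; apply: decP; rewrite mem_cat; apply/orP; right.
  exact: allpairs_f.
exists g, h; split=> // g' h' /gP Pg /hP Ph gh; have [_ _ PN] := coneP.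
apply/esym/subr0_eq/PN => //.
have -> : - (g - g') = h - h' by
  rewrite opprB; apply/eqP; rewrite subr_eq -addrA [- h' + g]addrC addrA;
  rewrite -subr_eq opprK gh addrC.
exact: Ph.
Qed.

End UniqueSum.

(** * Torsionfree gradings *)

Section TorsionfreeGrading.
Variables (G : zmodType) (R : comPzRingType) (Rg : G -> set R).
Variables (M : lmodType R) (Mg : G -> set M).
Hypotheses (gradR : ring_grading Rg) (gradM : module_grading Rg Mg).
Hypotheses (tfG : torsionfree G) (noethR : noetherian R).

Let decR : direct_sum_decomposition Rg := gradR.1.
Let decM : direct_sum_decomposition Mg := gradM.1.

Definition colon (N : set M) (u : M) : set R := [set a | N (a *: u)].

Lemma colon_submodule N u : submodule N -> submodule (colon N u : set R^o).
Proof.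
move=> subN; apply/submoduleP; split.
  by rewrite /colon /= scale0r; apply: submodule0.
move=> a b c Nb Nc; rewrite /colon /= scalerDl -scalerA.
by apply: submoduleD => //; apply: submoduleZ.
Qed.

Definition maximal_colon (N : set M) (v : M) : Prop :=
  [/\ homogeneous Mg v, ~ N v & forall w, homogeneous Mg w -> ~ N w ->
    colon N v `<=` colon N w -> colon N w `<=` colon N v].

Lemma maximal_colon_ex N u : submodule N -> homogeneous Mg u -> ~ N u ->
  exists v, maximal_colon N v.
Proof.
move=> subN.
have ind : forall I : set R^o, submodule I -> forall v, homogeneous Mg v ->
    ~ N v -> I = colon N v -> exists w, maximal_colon N w.
  apply: (noetherian_ind noethR) => I subI IH v homv NNv IE.
  apply: contrapT => nomax; apply: (nomax); exists v.
  split=> // w homw NNw vw; apply: contrapT => wv; apply: nomax.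
  apply: (IH (colon N w)) homw NNw erefl; first exact: colon_submodule.
    by rewrite IE.
  by move=> wI; apply: wv; rewrite wI IE.
by move=> homu NNu; apply: (ind _ (colon_submodule u subN)) homu NNu erefl.
Qed.

(** Among homogeneous scalars primality is the usual argument for maximal
annihilators: if b u is not in N then its colon ideal contains that of u, hence
equals it. For general scalars c and d, unique sums provide degrees g and h for
which exactly one product of components that are outside the colon ideal, that
of c_g and d_h, contributes in degree g + h. *)
Lemma maximal_colon_prime N u c d : graded_submodule Mg N ->
  maximal_colon N u -> ~ N (c *: u) -> ~ N (d *: u) -> ~ N ((c * d) *: u).
Proof.
move=> grN [[k Mu] NNu maxu] NNcu NNdu.
have [subN compN] := (graded_submoduleP gradR gradM N).1 grN.
have prime_hom a b : homogeneous Rg b ->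
    ~ N (a *: u) -> ~ N (b *: u) -> ~ N (a *: (b *: u)).
  move=> homb NNau NNbu Nabu; apply: NNau.
  apply: (maxu (b *: u) _ NNbu) Nabu.
    by apply: (homogeneousZ gradM homb); exists k.
  move=> e Neu; rewrite /colon /= scalerA mulrC -scalerA.
  exact: submoduleZ.
have [s [us cE _]] := sum_component decR c.
have [t [ut dE t0]] := sum_component decR d.
have nz r b : b = \sum_(g <- r) component Rg g b -> ~ N (b *: u) ->
    [seq g <- r | `[< ~ N (component Rg g b *: u) >]] != [::].
  move=> bE NNbu; rewrite -has_filter; apply/negPn/negP => /hasPn noN.
  apply: NNbu; rewrite bE scaler_suml; apply: submodule_sum => // g /noN.
  by move=> /asboolP/contrapT.
have [g [h [gS hT gh]]] := unique_sum tfG (nz _ _ cE NNcu) (nz _ _ dE NNdu).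
move: gS hT; rewrite !mem_filter => /andP[/asboolP NNg gs] /andP[/asboolP NNh ht].
move=> /(compN (g + h + k)); rewrite -scalerA {1}cE scaler_suml.
rewrite (component_sum decM) (bigD1_seq g) //=.
have termE g' : component Mg (g + h + k) (component Rg g' c *: (d *: u)) =
    component Rg g' c *: (component Rg (g + h - g') d *: u).
  rewrite (component_scale_homogeneous gradM _ _ (component_in decR g' c)).
  rewrite (component_scale_of_homogeneous gradR gradM _ _ Mu).
  by rewrite addrAC addrK.
have Nother g' : g' \in s -> g' != g ->
    N (component Mg (g + h + k) (component Rg g' c *: (d *: u))).
  move=> g's /eqP neq; rewrite termE; apply: contrapT => NNterm; apply: neq.
  have NNd' : ~ N (component Rg (g + h - g') d *: u).
    by move=> Nd; apply: NNterm; apply: submoduleZ.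
  apply: (gh g' (g + h - g')); last by rewrite addrC subrK.
    rewrite mem_filter g's andbT; apply/asboolP => Nc; apply: NNterm.
    by rewrite scalerA mulrC -scalerA; apply: submoduleZ.
  rewrite mem_filter; apply/andP; split; first exact/asboolP.
  apply: contrapT => /negP/t0 d0; apply: NNd'.
  by rewrite d0 scale0r; apply: submodule0.
rewrite addrC => Nsum.
have : N (component Mg (g + h + k) (component Rg g c *: (d *: u))).
  apply: (submoduleDl subN) Nsum; rewrite big_seq_cond.
  elim/big_ind: _ => [|x y Nx Ny|g' /andP[]]; last exact: Nother.
    exact: submodule0.
  exact: submoduleD.
rewrite termE [g + h]addrC addrK.
by apply: prime_hom => //; exists h; apply: component_in.
Qed.

(** N is not the meet of N + R v and N + R u, and a homogeneous element of
this meet outside N is, modulo N, a homogeneous multiple of v. *)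
Lemma homogeneous_multiple N u v : graded_irreducible_submodule Mg N ->
  homogeneous Mg u -> ~ N u -> homogeneous Mg v -> ~ N v ->
  exists b, [/\ homogeneous Rg b, ~ N (b *: v) & add_line N u (b *: v)].
Proof.
move=> [grN irrN] [k Mu] NNu [h Mv] NNv.
have [subN compN] := (graded_submoduleP gradR gradM N).1 grN.
have grA := graded_submodule_add_line gradR gradM grN Mv.
have grB := graded_submodule_add_line gradR gradM grN Mu.
have [x [[Ax Bx] NNx]] :
    exists x, (add_line N v `&` add_line N u) x /\ ~ N x.
  apply: contrapT => /forallNP noX.
  have eqN w : add_line N w = N -> N w by move=> <-; apply: mem_add_line.
  case: (irrN _ _ grA grB) => [|/eqN|/eqN] //.
  apply/seteqP; split=> [x ABx|x Nx].
    by apply: contrapT => NNx; apply: (noX x).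
  by split; apply: sub_add_line.
have [l NNw] := component_notin gradM subN NNx.
have Bw := ((graded_submoduleP gradR gradM _).1 grB).2 l _ Bx.
case: Ax NNw Bw => n Nn [b ->].
rewrite (componentD decM) (component_scale_of_homogeneous gradR gradM _ _ Mv).
move=> NNw Bw; exists (component Rg (l - h) b); split.
- by exists (l - h); apply: component_in.
- by move=> Nb; apply: NNw; apply: submoduleD => //; apply: compN.
- apply: submoduleDl Bw; first exact: add_line_submodule.
  by apply: sub_add_line; apply: compN.
Qed.

(** Induction on the number of components of x outside N: once a moves x minus
its component x_g into N + R u, a further homogeneous b moves a x_g there. *)
Lemma multiple_in_add_line N u x : graded_irreducible_submodule Mg N ->
  homogeneous Mg u -> ~ N u -> ~ N x ->
  exists a, [/\ homogeneous Rg a, ~ N (a *: x) & add_line N u (a *: x)].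
Proof.
move=> irrN homu NNu; have grN := irrN.1.
have [subN compN] := (graded_submoduleP gradR gradM N).1 grN.
have subB : submodule (add_line N u) by apply: add_line_submodule.
have [s [_ _ s0]] := sum_component decM x.
have {s0} : forall g, g \notin s -> N (component Mg g x).
  by move=> g /s0->; apply: submodule0.
elim: s x => [|g s IH] x sN NNx.
  by have [g []] := component_notin gradM subN NNx; apply: sN.
have [Ng|NNg] := pselect (N (component Mg g x)).
  apply: IH => // h hs; have [->//|/eqP hg] := pselect (h = g).
  by apply: sN; rewrite in_cons negb_or hg.
have Mg_ := component_in decM g x.
pose y := x - component Mg g x.
have xE : x = component Mg g x + y by rewrite addrC subrK.
have NNax a : homogeneous Rg a -> ~ N (a *: component Mg g x) -> ~ N (a *: x).
  move=> [e Ra] NNa /(compN (e + g)).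
  by rewrite (component_scale_homogeneous gradM _ _ Ra) addrAC subrr add0r.
have [Ny|NNy] := pselect (N y).
  have [|b [homb NNb Bb]] := homogeneous_multiple irrN homu NNu _ NNg.
    by exists g.
  exists b; split=> //; first exact: NNax.
  rewrite xE scalerDr; apply: (submoduleD subB) => //.
  by apply: sub_add_line; apply: submoduleZ.
have [|a [homa NNa Ba]] := IH y _ NNy.
  move=> h hs; have /eqP := componentD decM h (component Mg g x) y.
  rewrite -xE addrC -subr_eq => /eqP<-.
  rewrite (component_homogeneous decM h Mg_).
  have [->|/eqP hg] := pselect (h = g).
    by rewrite eqxx subrr; apply: submodule0.
  rewrite (negPf hg) subr0; apply: sN.
  by rewrite in_cons negb_or hg.
have [Nag|NNag] := pselect (N (a *: component Mg g x)).
  exists a; split=> //; rewrite xE scalerDr.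
    by move=> /(submoduleDl subN Nag).
  by apply: (submoduleD subB) => //; apply: sub_add_line.
have [|b [homb NNb Bb]] := homogeneous_multiple irrN homu NNu _ NNag.
  by apply: (homogeneousZ gradM homa); exists g.
exists (b * a); split; first exact: (homogeneousM gradR).
  apply: NNax; first exact: (homogeneousM gradR).
  by rewrite -scalerA.
rewrite xE scalerDr -!scalerA; apply: (submoduleD subB) => //.
exact: submoduleZ.
Qed.

Lemma torsionfree_graded_irreducible N :
  graded_irreducible_submodule Mg N -> irreducible_submodule N.
Proof.
move=> irrN; have grN := irrN.1.
have [subN compN] := (graded_submoduleP gradR gradM N).1 grN.
split=> // N1 N2 subN1 subN2 N12; apply: contrapT => /not_orP[N1N N2N].
have N_sub1 : N `<=` N1 by rewrite -N12; apply: subIsetl.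
have N_sub2 : N `<=` N2 by rewrite -N12; apply: subIsetr.
have proper X : N `<=` X -> X <> N -> exists2 x, X x & ~ N x.
  move=> NX neq; apply: contrapT => noX; apply: neq.
  apply/seteqP; split=> // x Xx; apply: contrapT => NNx.
  by apply: noX; exists x.
have [x N1x NNx] := proper _ N_sub1 N1N.
have [y N2y NNy] := proper _ N_sub2 N2N.
have [k NNk] := component_notin gradM subN NNx.
have homk : homogeneous Mg (component Mg k x).
  by exists k; apply: component_in.
have [u maxu] := maximal_colon_ex subN homk NNk; have [homu NNu _] := maxu.
have line X z : submodule X -> N `<=` X -> X z -> ~ N z ->
    exists2 c, X (c *: u) & ~ N (c *: u).
  move=> subX NX Xz NNz.
  have [a [_ + [n Nn [c azE]]]] := multiple_in_add_line irrN homu NNu NNz.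
  rewrite azE => NNaz; exists c; last first.
    by move=> Nc; apply: NNaz; apply: submoduleD.
  by apply: (submoduleDl subX (NX n Nn)); rewrite -azE; apply: submoduleZ.
have [c N1c NNc] := line _ _ subN1 N_sub1 N1x NNx.
have [d N2d NNd] := line _ _ subN2 N_sub2 N2y NNy.
apply: (maximal_colon_prime grN maxu NNc NNd).
rewrite -N12; split; last by rewrite -scalerA; apply: submoduleZ.
by rewrite mulrC -scalerA; apply: submoduleZ.
Qed.

End TorsionfreeGrading.

Theorem theorem4p5 (G : zmodType) (R : comPzRingType) (Rg : G -> set R)
    (M : lmodType R) (Mg : G -> set M) :
  ring_grading Rg -> noetherian R ->
  module_grading Rg Mg -> finitely_generated [set: M] ->
  let cond1 := forall N : set M,
    graded_irreducible_submodule Mg N -> irreducible_submodule N in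
  let cond2 := forall N : set M, graded_submodule Mg N ->
    index_of_reducibility N = graded_index_of_reducibility Mg N in
  let cond3 := forall N : set M, graded_submodule Mg N ->
    exists r : nat, intersection_of
      (fun L => irreducible_submodule L /\ graded_submodule Mg L) N r in
  [/\ cond1 <-> cond2, cond2 <-> cond3
    & torsionfree G -> [/\ cond1, cond2 & cond3]].
Proof.
move=> gradR noethR gradM fgM cond1 cond2 cond3.
have fg N := @submodule_finitely_generated _ _ N noethR fgM.
have subC := graded_submodule_submodule gradR gradM.
have C12 : cond1 <-> cond2.
  split; first exact: irreducible_in_index.
  exact: index_irreducible_in.
have C13 : cond1 <-> cond3.
  apply: irreducible_in_meet => //; first exact: (graded_submoduleT gradR gradM).
  exact: (graded_submoduleI gradR gradM).
split=> //; first by rewrite -C12.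
move=> tfG; have c1 : cond1 by apply: (torsionfree_graded_irreducible gradR gradM).
by split=> //; [apply/C12|apply/C13].
Qed.
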